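(* Let $\mathbf A$ be a finite relational structure such that the variety $\mathcal V(\mathrm{Alg}(\mathbf A))$ is not congruence modular. Then $\exists\mathrm{CSP}(\mathbf A)$ is not sublinear-query testable with one-sided error: there is $\epsilon>0$ such that every one-sided-error $\epsilon$-tester for $\exists\mathrm{CSP}(\mathbf A)$ makes a number of queries linear in the number of free variables on some instances.
   Context: $\mathrm{Alg}(\mathbf A)=(A;\mathrm{Pol}(\mathbf A))$ is the algebra of all polymorphisms of $\mathbf A$ (operations preserving every relation of $\mathbf A$ under coordinatewise application); $\mathcal V(\cdot)$ is the generated variety; a variety is congruence modular if the congruence lattice of each of its members satisfies the modular law. $\exists\mathrm{CSP}(\mathbf A)$: instances $(V,V^\exists,\mathcal C,w)$ with free variables $V$, existentially quantified variables $V^\exists$, constraints $\langle(x_1,\dots,x_k),R\rangle$ with $R$ a relation of $\mathbf A$, and weights $w:V\to[0,1]$ summing to 1; $f:V\to A$ is satisfying if it extends to an assignment of $V\cup V^\exists$ satisfying all constraints. $f$ is $\epsilon$-far if for every satisfying $g$, $\sum_{x\in V:f(x)\ne g(x)}w(x)>\epsilon$. A one-sided $\epsilon$-tester is given the instance and $\epsilon$, queries values of $f$, always accepts satisfying $f$, and rejects $\epsilon$-far $f$ with probability $\ge 2/3$. *)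

(* Defs.v *)
From HB Require Import structures.
From mathcomp Require Import all_boot.
From Stdlib Require Import Reals.

Set Implicit Arguments.
Unset Strict Implicit.
Unset Printing Implicit Defensive.

Record relstruct (A : finType) := RelStruct {
  nrel : nat;
  rarity : 'I_nrel -> nat;
  rrel : forall i : 'I_nrel, {set (rarity i).-tuple A} }.
Arguments nrel {A} r.
Arguments rarity {A} r i.
Arguments rrel {A} r i.

Definition is_pol (A : finType) (S : relstruct A) (k : nat)
  (f : {ffun k.+1.-tuple A -> A}) : bool :=
  [forall i : 'I_(nrel S), forall M : k.+1.-tuple ((rarity S i).-tuple A),
     [forall a : 'I_k.+1, tnth M a \in rrel S i] ==>
     ([tuple f [tuple tnth (tnth M a) j | a < k.+1] | j < rarity S i]
        \in rrel S i)].

Definition pol_op (A : finType) (S : relstruct A) : Type :=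
  {k : nat & {f : {ffun k.+1.-tuple A -> A} | is_pol S f}}.

Definition pol_ar (A : finType) (S : relstruct A) (o : pol_op S) : nat :=
  (projT1 o).+1.

Inductive term (O : Type) (ar : O -> nat) : Type :=
| Var : nat -> term ar
| App : forall o : O, ('I_(ar o) -> term ar) -> term ar.

Fixpoint eval (O : Type) (ar : O -> nat) (B : Type)
  (ip : forall o : O, ('I_(ar o) -> B) -> B) (v : nat -> B) (t : term ar) : B :=
  match t with
  | Var x => v x
  | App o ts => ip o (fun i => eval ip v (ts i))
  end.

Definition alg_interp (A : finType) (S : relstruct A) (o : pol_op S)
  (args : 'I_(pol_ar o) -> A) : A :=
  (sval (projT2 o)) [tuple args i | i < (projT1 o).+1].

(* An algebra (B; ip) of the signature of Alg(S) belongs to the variety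
   V(Alg(S)) iff it satisfies every identity satisfied by Alg(S)
   (Birkhoff: V(K) = Mod(Id(K))). *)
Definition in_variety (A : finType) (S : relstruct A) (B : Type)
  (ip : forall o : pol_op S, ('I_(pol_ar o) -> B) -> B) : Prop :=
  forall s t : term (@pol_ar A S),
    (forall v : nat -> A, eval (@alg_interp A S) v s = eval (@alg_interp A S) v t) ->
    forall v : nat -> B, eval ip v s = eval ip v t.

Definition is_cong (O : Type) (ar : O -> nat) (B : Type)
  (ip : forall o : O, ('I_(ar o) -> B) -> B) (th : B -> B -> Prop) : Prop :=
  (forall x, th x x) /\ (forall x y, th x y -> th y x) /\
  (forall x y z, th x y -> th y z -> th x z) /\
  (forall (o : O) (a b : 'I_(ar o) -> B), (forall i, th (a i) (b i)) ->
      th (ip o a) (ip o b)).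

Definition cong_join (O : Type) (ar : O -> nat) (B : Type)
  (ip : forall o : O, ('I_(ar o) -> B) -> B) (al be : B -> B -> Prop) :
  B -> B -> Prop :=
  fun x y => forall th, is_cong ip th ->
    (forall u w, al u w -> th u w) -> (forall u w, be u w -> th u w) -> th x y.

Definition cong_meet (B : Type) (al be : B -> B -> Prop) : B -> B -> Prop :=
  fun x y => al x y /\ be x y.

Definition con_modular (O : Type) (ar : O -> nat) (B : Type)
  (ip : forall o : O, ('I_(ar o) -> B) -> B) : Prop :=
  forall al be ga : B -> B -> Prop,
    is_cong ip al -> is_cong ip be -> is_cong ip ga ->
    (forall x y, al x y -> ga x y) ->
    forall x y, cong_meet (cong_join ip al be) ga x y <->
                cong_join ip al (cong_meet be ga) x y.

Definition CM_variety (A : finType) (S : relstruct A) : Prop :=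
  forall (B : Type) (ip : forall o : pol_op S, ('I_(pol_ar o) -> B) -> B),
    in_variety ip -> con_modular ip.

Definition constraint (A : finType) (S : relstruct A) (n m : nat) : Type :=
  {i : 'I_(nrel S) & (rarity S i).-tuple ('I_n + 'I_m)}.

Record instance (A : finType) (S : relstruct A) := Instance {
  nfree : nat;
  nex : nat;
  constraints : seq (constraint S nfree nex);
  weight : 'I_nfree -> R }.
Arguments nfree {A S} i.
Arguments nex {A S} i.
Arguments constraints {A S} i.
Arguments weight {A S} i _.

Definition total_weight (A : finType) (S : relstruct A) (I : instance S) : R :=
  \big[Rplus/0%R]_(x < nfree I) weight I x.

Definition valid_instance (A : finType) (S : relstruct A) (I : instance S) : Prop :=
  (forall x, Rle 0 (weight I x) /\ Rle (weight I x) 1) /\ total_weight I = 1%R.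

Definition satisfying (A : finType) (S : relstruct A) (I : instance S)
  (f : 'I_(nfree I) -> A) : Prop :=
  exists h : 'I_(nex I) -> A,
    forall c, c \in constraints I ->
      [tuple match tnth (projT2 c) j with inl x => f x | inr y => h y end
        | j < rarity S (projT1 c)] \in rrel S (projT1 c).

Definition dist (A : finType) (S : relstruct A) (I : instance S)
  (f g : 'I_(nfree I) -> A) : R :=
  \big[Rplus/0%R]_(x < nfree I | f x != g x) weight I x.

Definition eps_far (A : finType) (S : relstruct A) (I : instance S) (eps : R)
  (f : 'I_(nfree I) -> A) : Prop :=
  forall g, satisfying g -> Rlt eps (dist f g).

Inductive dtree (n : nat) (A : Type) : Type :=
| Leaf : bool -> dtree n A
| Query : 'I_n -> (A -> dtree n A) -> dtree n A.

Fixpoint decide (n : nat) (A : Type) (t : dtree n A) (f : 'I_n -> A) : bool :=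
  match t with
  | Leaf b => b
  | Query x k => decide (k (f x)) f
  end.

Fixpoint nqueries (n : nat) (A : Type) (t : dtree n A) (f : 'I_n -> A) : nat :=
  match t with
  | Leaf _ => 0
  | Query x k => (nqueries (k (f x)) f).+1
  end.

(* A randomized tester: on each instance, a finitely supported probability
   distribution over decision trees (list of (probability, tree)). *)
Definition tester (A : finType) (S : relstruct A) : Type :=
  forall I : instance S, seq (R * dtree (nfree I) A).

Definition valid_dist (n : nat) (A : Type) (D : seq (R * dtree n A)) : Prop :=
  (forall p, List.In p D -> Rle 0 p.1) /\
  \big[Rplus/0%R]_(p <- D) p.1 = 1%R.

Definition prob_reject (n : nat) (A : Type) (D : seq (R * dtree n A))
  (f : 'I_n -> A) : R :=
  \big[Rplus/0%R]_(p <- D) (if decide p.2 f then 0%R else p.1).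

Definition one_sided_tester (A : finType) (S : relstruct A) (eps : R)
  (T : tester S) : Prop :=
  forall I : instance S, valid_instance I ->
    valid_dist (T I) /\
    (forall f, satisfying f -> prob_reject (T I) f = 0%R) /\
    (forall f, eps_far eps f -> Rle (2/3) (prob_reject (T I) f)).

Definition makes_queries (A : finType) (S : relstruct A) (T : tester S)
  (I : instance S) (q : R) : Prop :=
  exists p, List.In p (T I) /\ Rlt 0 p.1 /\
    exists f : 'I_(nfree I) -> A, Rle q (INR (nqueries p.2 f)).

(* Main.v *)
Require Import Defs.
From HB Require Import structures.
From mathcomp Require Import all_boot.
From Stdlib Require Import Reals Lra FunctionalExtensionality.

Set Implicit Arguments.
Unset Strict Implicit.
Unset Printing Implicit Defensive.

(* If the variety is not congruence modular, Day's theorem says that no chain of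
   4-ary polymorphisms satisfying m(x,y,y,x) = x, consecutive ones agreeing on
   (x,x,u,u) or on (x,y,y,u), leads from the first projection to the last.

   Being a polymorphism is expressible by constraints on a table of values, so an
   existential instance can speak of such chains: given tables b, c, c', it asks
   for polymorphisms p, q with p(x,y,y,x) = q(x,y,y,x) = b(x,y), agreeing on
   (x,y,y,u), and restricting on (x,x,u,u) to c and c'.  This is a conditional
   equality: if b(x,y) = x ("true"), then c and c' stay connected, hence composing
   such links never leads from c(x,u) = x to c'(x,u) = u; if b(x,y) = y ("false"),
   the pair p, q = second, third projection makes exactly this step.

   With 2m blocks b_k, impose for every injective choice of m blocks the path of
   links through them from c to c'.  The assignment "all b_k true, c <> c'" is far
   from satisfying, since at least m blocks or one of c, c' must be changed,
   whereas making every block outside a set of fewer than m blocks false satisfies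
   the instance.  So a one-sided tester cannot reject before it has seen m blocks. *)

(** * Day's condition as a path in a graph of polymorphisms *)

Notation op4 A := {ffun 4.-tuple A -> A}.

Definition i0 : 'I_4 := @Ordinal 4 0 isT.
Definition i1 : 'I_4 := @Ordinal 4 1 isT.
Definition i2 : 'I_4 := @Ordinal 4 2 isT.
Definition i3 : 'I_4 := @Ordinal 4 3 isT.

Definition proj4 (A : finType) (i : 'I_4) : op4 A := [ffun t => tnth t i].

Lemma proj4_is_pol (A : finType) (S : relstruct A) (i : 'I_4) :
  is_pol S (proj4 A i).
Proof.
apply/forallP=> r; apply/forallP=> M; apply/implyP=> /forallP /(_ i) Mi.
suff -> : [tuple proj4 A i [tuple tnth (tnth M a) j | a < 4] | j < rarity S r] = tnth M i by [].
apply: eq_from_tnth => j.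
by rewrite tnth_mktuple ffunE tnth_mktuple.
Qed.

Definition day_diag (A : finType) (f : op4 A) : bool :=
  [forall x, forall y, f [tuple x; y; y; x] == x].

Definition day_outer (A : finType) (f g : op4 A) : bool :=
  [forall x, forall u, f [tuple x; x; u; u] == g [tuple x; x; u; u]].

Definition day_inner (A : finType) (f g : op4 A) : bool :=
  [forall x, forall y, forall u,
    f [tuple x; y; y; u] == g [tuple x; y; y; u]].

Definition day_vertex (A : finType) (S : relstruct A) (f : op4 A) : bool :=
  is_pol S f && day_diag f.

(** Day's terms alternate the two identities by parity; since a term may be repeated, allowing the
    two kinds of edge in any order is equivalent. *)
Definition day_rel (A : finType) (S : relstruct A) : rel (op4 A) :=
  fun f g => [&& day_vertex S f, day_vertex S g & day_outer f g || day_inner f g].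

(* Day's Mal'cev condition: a chain of Day terms is exactly a path from the
   first to the last projection in the graph [day_rel]. *)
Definition has_day_chain (A : finType) (S : relstruct A) : bool :=
  connect (day_rel S) (proj4 A i0) (proj4 A i3).

(** * Transfer of 4-ary identities to the variety *)

Definition quad (B : Type) (a b c d : B) (n : nat) : B :=
  match n with 0 => a | 1 => b | 2 => c | _ => d end.

Definition pol4_op (A : finType) (S : relstruct A) (f : op4 A)
  (pf : is_pol S f) : pol_op S :=
  existT (fun k => {g : {ffun k.+1.-tuple A -> A} | is_pol S g}) 3
         (exist (fun g => is_pol S g) f pf).

Definition app4 (A : finType) (S : relstruct A) (B : Type)
  (ip : forall o : pol_op S, ('I_(pol_ar o) -> B) -> B)
  (f : op4 A) (pf : is_pol S f) (a b c d : B) : B :=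
  ip (pol4_op pf) (fun i : 'I_4 => quad a b c d i).

Definition term4 (A : finType) (S : relstruct A) (f : op4 A)
  (pf : is_pol S f) (a b c d : nat) : term (@pol_ar A S) :=
  @App _ (@pol_ar A S) (pol4_op pf)
       (fun i : 'I_4 => Var (@pol_ar A S) (quad a b c d i)).

Lemma eval_term4 (A : finType) (S : relstruct A) (B : Type)
  (ip : forall o : pol_op S, ('I_(pol_ar o) -> B) -> B)
  (f : op4 A) (pf : is_pol S f) (v : nat -> B) (a b c d : nat) :
  eval ip v (term4 pf a b c d) = app4 ip pf (v a) (v b) (v c) (v d).
Proof.
rewrite /= /app4; congr (ip _ _); apply: functional_extensionality => i.
by case: (nat_of_ord i) => [|[|[|?]]].
Qed.

Lemma app4_alg (A : finType) (S : relstruct A) (f : op4 A) (pf : is_pol S f)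
  (a b c d : A) : app4 (@alg_interp A S) pf a b c d = f [tuple a; b; c; d].
Proof.
rewrite /app4 /alg_interp /=; congr (f _).
apply: eq_from_tnth => i; rewrite tnth_mktuple.
by case: i => [[|[|[|[|?]]]] //= ?].
Qed.

(** The indices are variable numbers; repeating one encodes a pattern such as (x,x,u,u), so the
    hypothesis is an identity of the polymorphism algebra. *)
Lemma app4_transfer (A : finType) (S : relstruct A) (B : Type)
  (ip : forall o : pol_op S, ('I_(pol_ar o) -> B) -> B)
  (f g : op4 A) (pf : is_pol S f) (pg : is_pol S g) (i j k l : nat) :
  in_variety ip ->
  (forall v : nat -> A, f [tuple v i; v j; v k; v l] = g [tuple v i; v j; v k; v l]) ->
  forall v : nat -> B,
    app4 ip pf (v i) (v j) (v k) (v l) = app4 ip pg (v i) (v j) (v k) (v l).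
Proof.
move=> inV fg v; rewrite -!eval_term4; apply: inV => {}v.
by rewrite !eval_term4 !app4_alg.
Qed.

Lemma app4_transfer_var (A : finType) (S : relstruct A) (B : Type)
  (ip : forall o : pol_op S, ('I_(pol_ar o) -> B) -> B)
  (f : op4 A) (pf : is_pol S f) (i j k l n : nat) :
  in_variety ip ->
  (forall v : nat -> A, f [tuple v i; v j; v k; v l] = v n) ->
  forall v : nat -> B, app4 ip pf (v i) (v j) (v k) (v l) = v n.
Proof.
move=> inV fn v; rewrite -eval_term4.
apply: (inV _ (Var (@pol_ar A S) n)) => {}v.
by rewrite eval_term4 app4_alg.
Qed.

Lemma app4_rel (A : finType) (S : relstruct A) (B : Type)
  (ip : forall o : pol_op S, ('I_(pol_ar o) -> B) -> B)
  (th : B -> B -> Prop) (f : op4 A) (pf : is_pol S f) a b c d a' b' c' d' :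
  (forall (o : pol_op S) (a b : 'I_(pol_ar o) -> B),
     (forall i, th (a i) (b i)) -> th (ip o a) (ip o b)) ->
  th a a' -> th b b' -> th c c' -> th d d' ->
  th (app4 ip pf a b c d) (app4 ip pf a' b' c' d').
Proof.
move=> comp ? ? ? ?; apply: comp => i.
by case: (nat_of_ord i) => [|[|[|?]]].
Qed.

(** * Joins of congruences as alternations, and modularity from a Day chain *)

(** Doubling the length puts an [al]-step in the middle of two halves of equal level, the form in
    which a-b-c-d can be shortened by induction. *)
Fixpoint alternation (B : Type) (al be : B -> B -> Prop) (n : nat) : B -> B -> Prop :=
  match n with
  | 0 => be
  | n'.+1 => fun x y => exists z w,
      alternation al be n' x z /\ al z w /\ alternation al be n' w y
  end.

Section Alternation.
Context (O : Type) (ar : O -> nat) (B : Type)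
  (ip : forall o : O, ('I_(ar o) -> B) -> B) (al be : B -> B -> Prop).
Hypotheses (cal : is_cong ip al) (cbe : is_cong ip be).
Let alt := alternation al be.

Lemma alternation_refl n x : alt n x x.
Proof.
elim: n x => [|n IHn] x; first by case: cbe => rbe _; exact: rbe.
exists x, x; split; first exact: IHn.
by split; [case: cal => ral _; exact: ral | exact: IHn].
Qed.

Lemma alternation_sym n x y : alt n x y -> alt n y x.
Proof.
elim: n x y => [|n IHn] x y; first by case: cbe => _ [+ _]; exact.
move=> [z [w [xz [zw wy]]]]; exists w, z; split; first exact: IHn.
by split; [case: cal => _ [+ _]; apply | exact: IHn].
Qed.

Lemma alternation_comp n (o : O) (a b : 'I_(ar o) -> B) :
  (forall i, alt n (a i) (b i)) -> alt n (@ip o a) (@ip o b).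
Proof.
elim: n a b => [|n IHn] a b ab; first by case: cbe => _ [_ [_]]; exact.
have [z /fin_all_exists [w zw]] := fin_all_exists ab.
exists (@ip o z), (@ip o w); split; first by apply: IHn => i; case: (zw i).
split; last by apply: IHn => i; case: (zw i) => ? [].
by case: cal => _ [_ [_]]; apply => i; case: (zw i) => ? [].
Qed.

Lemma alternation_leq m n x y : (m <= n)%N -> alt m x y -> alt n x y.
Proof.
move=> /subnK <-; elim: (n - m)%N => // k IHk /IHk xy.
exists y, y; split => //.
by split; [case: cal => ral _; exact: ral | exact: alternation_refl].
Qed.

(** Arities are finite, so the levels needed for the single arguments have a maximum. *)
Lemma alternation_cong : is_cong ip (fun x y => exists n, alt n x y).
Proof.
split; first by move=> x; exists 0; exact: alternation_refl.
split; first by move=> x y [n xy]; exists n; exact: alternation_sym.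
split.
  move=> x y z [n xy] [k yz]; exists (maxn n k).+1, y, y; split.
    by apply: alternation_leq xy; rewrite leq_maxl.
  split; last by apply: alternation_leq yz; rewrite leq_maxr.
  by case: cal => ral _; exact: ral.
move=> o a b /fin_all_exists [n ab]; exists (\max_i n i).
apply: alternation_comp => i; apply: alternation_leq (ab i).
exact: leq_bigmax.
Qed.

Lemma cong_join_alternation x y : cong_join ip al be x y -> exists n, alt n x y.
Proof.
move=> xy; apply: (xy _ alternation_cong).
- move=> u w uw; exists 1, u, w; split; first exact: (alternation_refl 0).
  by split => //; exact: (alternation_refl 0).
- by move=> u w uw; exists 0.
Qed.

Lemma cong_join_is_cong : is_cong ip (cong_join ip al be).
Proof.
split; first by move=> x th [? _].
split; first by move=> x y xy th cth ? ?; case: (cth) => _ [+ _]; apply; exact: xy.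
split.
  move=> x y z xy yz th cth h1 h2; case: (cth) => _ [_ [+ _]].
  by apply; [exact: xy | exact: yz].
move=> o a b ab th cth h1 h2; case: (cth) => _ [_ [_]]; apply => i.
exact: ab.
Qed.

End Alternation.

(* The step from (a,d) to the pairs (m(a,a,d,d), m(a,b,c,d)) shortens an
   alternation a-b-c-d while staying inside one [ga]-class, as every m on the
   path satisfies m(x,y,y,x) = x. *)
Lemma day_chain_modular (A : finType) (S : relstruct A) (B : Type)
  (ip : forall o : pol_op S, ('I_(pol_ar o) -> B) -> B) :
  has_day_chain S -> in_variety ip -> con_modular ip.
Proof.
move=> day inV al be ga cal cbe cga alga.
set de := cong_join ip al (cong_meet be ga).
have [rde [sde [tde ode]]] : is_cong ip de := cong_join_is_cong ip al (cong_meet be ga).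
have [rga [sga [tga oga]]] := cga.
move=> x y; split; last first.
  move=> xy; split.
    by move=> th cth h1 h2; apply: xy => // u w [] /h2.
  by apply: xy => // u w [].
move=> [/(cong_join_alternation cal cbe) [n]].
elim: n x y => [|n IHn] a d.
  by move=> ad adg th _ _; apply.
move=> [b [c [ab [bc cd]]]] adg.
have diagB (f : op4 A) (pf : is_pol S f) : day_diag f ->
    forall u w, app4 ip pf u w w u = u.
  move=> /forallP df u w.
  apply: (app4_transfer_var pf (i := 0) (j := 1) (k := 1) (l := 0) (n := 0) inV _ (quad u w w w)).
  by move=> v; apply/eqP; move/forallP: (df (v 0)).
have shift (f : op4 A) (pf : is_pol S f) : day_diag f ->
    de (app4 ip pf a a d d) (app4 ip pf a b c d).
  move=> df; apply: IHn.
    apply: (app4_rel pf (alternation_comp cal cbe (n := n))) => //;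
      try exact: alternation_refl cal cbe _ _.
    exact: alternation_sym cal cbe _ _ _ cd.
  (* Both sides are [ga]-related to a = m(a,a,a,a) = m(a,b,b,a), because a [ga] d and b [al] c. *)
  apply: (tga _ a).
    rewrite -[X in ga _ X](diagB f pf df a a).
    by apply: (app4_rel pf oga) => //; apply: sga.
  rewrite -[X in ga X _](diagB f pf df a b).
  by apply: (app4_rel pf oga) => //; exact: alga.
have bcd : de b c by move=> th _ h _; apply: h.
suff path_de p (f : op4 A) (pf : is_pol S f) :
    path (day_rel S) f p ->
    forall pl : is_pol S (last f p),
      de (app4 ip pf a a d d) (app4 ip pl a a d d).
  have [p Sp e] := connectP day.
  have pl : is_pol S (last (proj4 A i0) p) by rewrite -e; exact: proj4_is_pol.
  have := path_de p _ (proj4_is_pol S i0) Sp pl.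
  have -> : app4 ip (proj4_is_pol S i0) a a d d = a.
    apply: (app4_transfer_var _ (i := 0) (j := 0) (k := 1) (l := 1) (n := 0) inV _ (quad a d d d)).
    by move=> v; rewrite ffunE.
  suff -> : app4 ip pl a a d d = d by [].
  apply: (app4_transfer_var _ (i := 0) (j := 0) (k := 1) (l := 1) (n := 1) inV _ (quad a d d d)).
  by move=> v; rewrite -e ffunE.
elim: p f pf => [|g p IHp] f pf /=.
  by move=> _ pl; rewrite (bool_irrelevance pl pf); exact: rde.
move=> /andP[/and3P[/andP[_ df] /andP[pg dg] fg] Sp] pl.
apply: (tde _ _ _ _ (IHp g pg Sp pl)).
case/orP: fg => /forallP fg.
  suff -> : app4 ip pf a a d d = app4 ip pg a a d d by exact: rde.
  apply: (app4_transfer _ _ (i := 0) (j := 0) (k := 1) (l := 1) inV _ (quad a d d d)).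
  by move=> v; apply/eqP; move/forallP: (fg (v 0)).
(* For an inner edge: f(a,a,d,d), f(a,b,c,d), f(a,b,b,d) = g(a,b,b,d), g(a,b,c,d), g(a,a,d,d) are
   successively [de]-related. *)
apply: (tde _ _ _ (shift f pf df)).
apply: (tde _ _ _ _ (sde _ _ (shift g pg dg))).
apply: (tde _ (app4 ip pf a b b d)).
  by apply: (app4_rel pf ode) => //; exact: sde.
suff -> : app4 ip pf a b b d = app4 ip pg a b b d.
  by apply: (app4_rel pg ode).
apply: (app4_transfer _ _ (i := 0) (j := 1) (k := 1) (l := 2) inV _ (quad a b d d)).
by move=> v; apply/eqP; move/forallP: (fg (v 0)) => /(_ (v 1)) /forallP.
Qed.

(** * The gadget instance *)

Definition chain_ix m := {ffun 'I_m -> 'I_m.*2}.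

(* Free variables: [m.*2] blocks [b_k(s,t)], and two tables [c(s,t)], [c'(s,t)]
   (tagged [false] and [true]).  Only [c] carries its diagonal; the diagonal
   entries of the other tables are idle, since they would have to be identified
   with those of [c]. *)
Definition free_var (A : finType) m : finType :=
  ('I_m.*2 * (A * A) + bool * (A * A))%type.

(** Each [phi] has its own copy: the inner tables c_j, the values on (x,y,y,u) shared by p_k and
    q_k, and their remaining values, separate for each side. *)
Definition bound_var (A : finType) m : finType :=
  (chain_ix m * ('I_m.+1 * (A * A)
     + ('I_m * (A * A * A) + 'I_m * bool * 4.-tuple A)))%type.


Definition link_var (A : finType) m (phi : chain_ix m) (j : nat) (s t : A) :
  free_var A m + bound_var A m :=
  if j == 0 then inl (inr (false, (s, t)))
  else if j == m then inl (inr (true, (s, t)))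
  else inr (phi, inl (inord j, (s, t))).

(* The k-th step of the chain [phi] is a pair (p_k, q_k), tagged by [side], of
   unknown 4-ary polymorphisms, with p_k(x,y,y,x) = q_k(x,y,y,x) = b_(phi k)(x,y),
   p_k(x,y,y,u) = q_k(x,y,y,u), p_k(x,x,u,u) = c_k(x,u) and
   q_k(x,x,u,u) = c_(k+1)(x,u), where c_0 = c and c_m = c'. *)
Definition step_var (A : finType) m (phi : chain_ix m) (k : 'I_m) (side : bool)
  (t : 4.-tuple A) : free_var A m + bound_var A m :=
  let x := tnth t i0 in let y := tnth t i1 in
  let z := tnth t i2 in let u := tnth t i3 in
  if y == z then
    if x == u then
      if x == y then inl (inr (false, (x, x))) else inl (inl (phi k, (x, y)))
    else inr (phi, inr (inl (k, (x, y, u))))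
  else if (x == y) && (z == u) then link_var phi (k + side) x z
  else inr (phi, inr (inr (k, side, t))).

Lemma step_varE (A : finType) m (phi : chain_ix m) (k : 'I_m) side (x y z u : A) :
  step_var phi k side [tuple x; y; z; u] =
  if y == z then
    if x == u then
      if x == y then inl (inr (false, (x, x))) else inl (inl (phi k, (x, y)))
    else inr (phi, inr (inl (k, (x, y, u))))
  else if (x == y) && (z == u) then link_var phi (k + side) x z
  else inr (phi, inr (inr (k, side, [tuple x; y; z; u]))).
Proof. by []. Qed.

Definition var_ord (A : finType) m (v : free_var A m + bound_var A m) :
  'I_#|free_var A m| + 'I_#|bound_var A m| :=
  match v with inl x => inl (enum_rank x) | inr y => inr (enum_rank y) end.

(** An index is one case of the preservation condition for p_k or q_k: a relation and four tuples of
    its arity. *)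
Definition gadget_ix (A : finType) (S : relstruct A) m : finType :=
  (chain_ix m * 'I_m * bool *
    {i : 'I_(nrel S) & 4.-tuple ((rarity S i).-tuple A)})%type.


Definition gadget_constraint (A : finType) (S : relstruct A) m (d : gadget_ix S m) :
  constraint S #|free_var A m| #|bound_var A m| :=
  let: (phi, k, side, existT i M) := d in
  existT (fun i => (rarity S i).-tuple _) i
    [tuple var_ord (step_var phi k side [tuple tnth (tnth M a) j | a < 4])
      | j < rarity S i].

Definition gadget_ok (A : finType) (S : relstruct A) m (d : gadget_ix S m) : bool :=
  let: (phi, k, side, existT i M) := d in
  injectiveb phi && [forall a, tnth M a \in rrel S i].

(** Half of the weight is spread over the blocks and half over c and c', so an entry of c or c' has
    a weight independent of [m]. *)
Definition gadget_weight (A : finType) m (v : free_var A m) : R :=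
  match v with
  | inl _ => (/ (2 * INR #|{: 'I_m.*2 * (A * A)}|))%R
  | inr _ => (/ (2 * INR #|{: bool * (A * A)}|))%R
  end.

Definition gadget (A : finType) (S : relstruct A) m : instance S :=
  @Instance A S #|free_var A m| #|bound_var A m|
    [seq gadget_constraint d | d <- enum (@gadget_ok A S m)]
    (fun x => gadget_weight (enum_val x)).

(** * Satisfying assignments as chains of polymorphisms *)

Definition step_op (A : finType) m (f : free_var A m -> A) (h : bound_var A m -> A)
  (phi : chain_ix m) (k : 'I_m) (side : bool) : op4 A :=
  [ffun t => match step_var phi k side t with inl x => f x | inr y => h y end].

Lemma gadget_satisfying (A : finType) (S : relstruct A) m
  (f : 'I_(nfree (gadget S m)) -> A) :
  satisfying f <-> exists h : bound_var A m -> A,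
    forall phi k side, injective (fun_of_fin phi) ->
      is_pol S (step_op (fun x => f (enum_rank x)) h phi k side).
Proof.
have step h phi k side t :
    match var_ord (step_var phi k side t) with inl x => f x | inr y => h y end
    = step_op (fun x => f (enum_rank x)) (fun y => h (enum_rank y)) phi k side t.
  by rewrite ffunE; case: (step_var _ _ _ _).
split=> [[h sat]|[h sat]].
  exists (fun y => h (enum_rank y)) => phi k side /injectiveP inj.
  apply/forallP=> i; apply/forallP=> M; apply/implyP=> Mi.
  have /sat : gadget_constraint (phi, k, side, existT _ i M) \in constraints (gadget S m).
    by apply: map_f; rewrite mem_enum; apply/andP.
  suff -> : [tuple match tnth (projT2 (gadget_constraint (phi, k, side, existT _ i M))) j
      with inl x => f x | inr y => h y end | j < rarity S i] =
    [tuple step_op (fun x => f (enum_rank x)) (fun y => h (enum_rank y)) phi k side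
      [tuple tnth (tnth M a) j | a < 4] | j < rarity S i] by [].
  by apply: eq_from_tnth => j; rewrite !tnth_mktuple step.
exists (fun y => h (enum_val y)) => c /mapP [[[[phi k] side] [i M]]].
rewrite mem_enum => /andP[/injectiveP inj Mi] -> /=.
have /forallP /(_ i) /forallP /(_ M) /implyP /(_ Mi) := sat phi k side inj.
suff <- : [tuple match tnth (projT2 (gadget_constraint (phi, k, side, existT _ i M))) j
    with inl x => f x | inr y => h (enum_val y) end | j < rarity S i] =
  [tuple step_op (fun x => f (enum_rank x)) h phi k side
    [tuple tnth (tnth M a) j | a < 4] | j < rarity S i] by [].
apply: eq_from_tnth => j; rewrite !tnth_mktuple step.
by rewrite !ffunE; case: (step_var _ _ _ _) => // y; rewrite enum_rankK.
Qed.

Lemma step_op_diag (A : finType) m (f : free_var A m -> A) h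
  (phi : chain_ix m) k side :
  (forall s t, f (inl (phi k, (s, t))) = s) -> (forall s, f (inr (false, (s, s))) = s) ->
  day_diag (step_op f h phi k side).
Proof.
move=> fb fc; apply/forallP=> x; apply/forallP=> y.
by apply/eqP; rewrite ffunE step_varE (eqxx x) (eqxx y); case: eqP => _; rewrite ?fc ?fb.
Qed.

Lemma step_op_inner (A : finType) m (f : free_var A m -> A) h
  (phi : chain_ix m) k :
  day_inner (step_op f h phi k false) (step_op f h phi k true).
Proof.
apply/forallP=> x; apply/forallP=> y; apply/forallP=> u.
by apply/eqP; rewrite !ffunE !step_varE (eqxx y).
Qed.

Lemma step_op_outer (A : finType) m (f : free_var A m -> A) h
  (phi : chain_ix m) k side x u :
  step_op f h phi k side [tuple x; x; u; u] =
  if x == u then f (inr (false, (x, x))) else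
  match link_var phi (k + side) x u with inl x => f x | inr y => h y end.
Proof.
by rewrite ffunE step_varE (eqxx x) (eqxx u); case: eqP => // ->.
Qed.

(** True blocks make every p_k and q_k a vertex; p_k to q_k is an inner edge, q_k to p_(k+1) an
    outer one through c_(k+1), and c, c' attach the two projections. *)
Lemma unchanged_chain_day (A : finType) (S : relstruct A) m
  (f : free_var A m -> A) (h : bound_var A m -> A) (phi : chain_ix m) :
  (0 < m)%N ->
  (forall k side, is_pol S (step_op f h phi k side)) ->
  (forall k s t, f (inl (phi k, (s, t))) = s) ->
  (forall s t, f (inr (false, (s, t))) = s) ->
  (forall s t, f (inr (true, (s, t))) = t) ->
  has_day_chain S.
Proof.
move=> m0 pol fb fc fc'.
have vtx k side : day_vertex S (step_op f h phi k side).
  by rewrite /day_vertex pol /=; apply: step_op_diag.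
have pvtx i : i \in [:: i0; i3] -> day_vertex S (proj4 A i).
  rewrite !inE => i03; rewrite /day_vertex proj4_is_pol /=.
  apply/forallP=> x; apply/forallP=> y; rewrite ffunE.
  by case/orP: i03 => /eqP ->.
have inner k : day_rel S (step_op f h phi k false) (step_op f h phi k true).
  by rewrite /day_rel !vtx step_op_inner orbT.
have first : day_rel S (proj4 A i0) (step_op f h phi (Ordinal m0) false).
  rewrite /day_rel vtx pvtx //=; apply/orP; left.
  apply/forallP=> x; apply/forallP=> u; rewrite step_op_outer ffunE /link_var /= !fc.
  by case: ifP.
have reach k : forall km : (k < m)%N,
    connect (day_rel S) (proj4 A i0) (step_op f h phi (Ordinal km) true).
  elim: k => [|k IHk] km.
    apply: connect_trans (connect1 (inner _)).
    by rewrite (bool_irrelevance km m0); exact: connect1.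
  apply: connect_trans (connect1 (inner _)).
  apply: connect_trans (IHk (ltnW km)) (connect1 _).
  rewrite /day_rel !vtx /=; apply/orP; left.
  apply/forallP=> x; apply/forallP=> u.
  by rewrite !step_op_outer /= addn1 addn0.
have mm : (m.-1 < m)%N by rewrite prednK.
apply: connect_trans (reach _ mm) (connect1 _).
rewrite /day_rel vtx pvtx ?inE ?eqxx ?orbT //=; apply/orP; left.
apply/forallP=> x; apply/forallP=> u.
apply/eqP; rewrite step_op_outer ffunE /link_var /= addn1 prednK //.
by rewrite (gtn_eqF m0) eqxx fc fc'; case: eqP.
Qed.

(** * Assignments with few true blocks *)

(** [Q] is the set of true blocks; the full set gives the far assignment. *)
Definition switched (A : finType) m (Q : {set 'I_m.*2}) (v : free_var A m) : A :=
  match v with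
  | inl (k, (s, t)) => if k \in Q then s else t
  | inr (b, (s, t)) => if b then t else s
  end.

(** Projections suffice: first or fourth at a true block, second or third at a false one. The change
    from x to u takes place inside one false step, where the second and third agree on (x,y,y,u). *)
Lemma switched_extends (A : finType) m (Q : {set 'I_m.*2}) :
  (forall phi : chain_ix m, injective phi -> exists k, phi k \notin Q) ->
  exists h : bound_var A m -> A, forall phi k side,
    injective (fun_of_fin phi) ->
    exists i, step_op (switched Q) h phi k side = proj4 A i.
Proof.
move=> miss.
(* c_j switches from s to t right after the step at [brk phi], where b reads y. *)
pose brk (phi : chain_ix m) : nat := if [pick k | phi k \notin Q] is Some k then k else 0.
pose ix (phi : chain_ix m) (k : 'I_m) (j : nat) : 'I_4 :=
  if phi k \in Q then (if (j <= brk phi)%N then i0 else i3)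
  else (if (j <= brk phi)%N then i1 else i2).
pose h (v : bound_var A m) : A :=
  match v with
  | (phi, inl (j, (s, t))) => if (j <= brk phi)%N then s else t
  | (phi, inr (inl (k, (x, y, u)))) => tnth [tuple x; y; y; u] (ix phi k k)
  | (phi, inr (inr (k, side, t))) => tnth t (ix phi k (k + side))
  end.
exists h => phi k side inj; exists (ix phi k (k + side)).
have [brkm brkQ] : (brk phi < m)%N /\ (phi k \in Q -> nat_of_ord k <> brk phi).
  rewrite /brk; case: pickP => [l lQ|none]; last first.
    by have [l lQ] := miss phi inj; rewrite none in lQ.
  split=> // kQ /val_inj kl; by rewrite -kl kQ in lQ.
apply/ffunP=> t; rewrite !ffunE /step_var.
case: t => [[|x [|y [|z [|u [|]]]]]] //= szt.
rewrite /tnth /=.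
case: (y =P z) => [yz|nyz].
  subst z; case: (x =P u) => [xu|nxu].
    subst u; rewrite /ix; case: (x =P y) => [xy|nxy] /=.
      by subst y; do !case: ifP.
    by do !case: ifP.
  rewrite /h /ix; case: ifP => [kQ|_]; last by do !case: ifP.
  (* A true block is not the breaking step, so p_k and q_k are the same projection. *)
  have -> : (k + side <= brk phi)%N = (k <= brk phi)%N.
    case: side; last by rewrite addn0.
    by rewrite addn1 [RHS]leq_eqVlt; case: eqP => // /brkQ; rewrite kQ; case.
  by case: ifP.
case: andP => [[/eqP xy /eqP zu]|//]; subst y u; rewrite /link_var.
case: (k + side =P 0)%N => [->|j0]; first by rewrite /ix /=; case: ifP.
case: (k + side =P m)%N => [->|jm] /=.
  by rewrite /ix leqNgt brkm /=; case: ifP.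
rewrite inordK; last by rewrite ltnS; case: (side); rewrite ?addn1 ?addn0 ?(ltnW (ltn_ord k)).
by rewrite /ix; do !case: ifP.
Qed.

Lemma switched_satisfying (A : finType) (S : relstruct A) m (Q : {set 'I_m.*2}) :
  (#|Q| < m)%N ->
  @satisfying A S (gadget S m) (fun x => switched Q (enum_val x)).
Proof.
move=> Qm; apply/gadget_satisfying.
have [phi inj|h hP] := @switched_extends A m Q.
  (* Pigeonhole: [m] distinct blocks do not fit into [Q]. *)
  apply/existsP; rewrite -negb_forall; apply/negP=> /forallP sub.
  suff : (m <= #|Q|)%N by rewrite leqNgt Qm.
  rewrite -[X in (X <= _)%N]card_ord -cardsT -(card_imset _ inj).
  by apply/subset_leq_card/subsetP => _ /imsetP[k _ ->].
exists h => phi k side /(hP phi k side)[i].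
have -> : step_op (fun x => switched Q (enum_val (enum_rank x))) h phi k side =
          step_op (switched Q) h phi k side.
  by apply/ffunP=> t; rewrite !ffunE; case: (step_var _ _ _ _) => // x; rewrite enum_rankK.
by move=> ->; exact: proj4_is_pol.
Qed.

(** * Decision trees, real sums and rejection probability *)

Fixpoint queried (n : nat) (A : Type) (t : dtree n A) (f : 'I_n -> A) : seq 'I_n :=
  match t with
  | Leaf _ => [::]
  | Query x k => x :: queried (k (f x)) f
  end.

Lemma size_queried (n : nat) (A : Type) (t : dtree n A) (f : 'I_n -> A) :
  size (queried t f) = nqueries t f.
Proof. by elim: t => //= x k ->. Qed.

Lemma decide_queried (n : nat) (A : Type) (t : dtree n A) (f g : 'I_n -> A) :
  (forall x, x \in queried t f -> f x = g x) -> decide t f = decide t g.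
Proof.
elim: t => //= x k IHk fg.
rewrite -fg ?mem_head //; apply: IHk => y yq.
by apply: fg; rewrite inE yq orbT.
Qed.

HB.instance Definition _ := Monoid.isComLaw.Build R 0%R Rplus
  (fun x y z => esym (Rplus_assoc x y z)) Rplus_comm Rplus_0_l.

Lemma Rsum_ge0 (I : Type) (r : seq I) (P : pred I) (F : I -> R) :
  (forall i, P i -> (0 <= F i)%R) -> (0 <= \big[Rplus/0%R]_(i <- r | P i) F i)%R.
Proof. by move=> F0; apply: big_ind => //= *; lra. Qed.

Lemma Rsum_le (I : Type) (r : seq I) (P : pred I) (F G : I -> R) :
  (forall i, P i -> (F i <= G i)%R) ->
  (\big[Rplus/0%R]_(i <- r | P i) F i <= \big[Rplus/0%R]_(i <- r | P i) G i)%R.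
Proof. by move=> FG; apply: big_ind2 => //= *; lra. Qed.

Lemma Rsum_const (T : finType) (P : pred T) (c : R) :
  \big[Rplus/0%R]_(i | P i) c = (INR #|P| * c)%R.
Proof.
rewrite big_const; elim: #|P| => [|n IHn]; first by rewrite /=; lra.
by rewrite iterS IHn S_INR; lra.
Qed.

Lemma Rsum_ge_card (T : finType) (P C : pred T) (F : T -> R) (c : R) :
  (forall i, P i -> (0 <= F i)%R) -> (forall i, C i -> P i /\ (c <= F i)%R) ->
  (INR #|C| * c <= \big[Rplus/0%R]_(i | P i) F i)%R.
Proof.
move=> F0 CF; rewrite -Rsum_const (bigID C P) /=.
rewrite (eq_bigl (fun i => P i && C i)); last first.
  by move=> i; case Ci: (C i); rewrite ?andbF // andbT; have [-> _] := CF i Ci.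
have := @Rsum_le T (index_enum T) (fun i => P i && C i) (fun=> c) F.
have := @Rsum_ge0 T (index_enum T) (fun i => P i && ~~ C i) F.
move=> h1 h2.
have {}h1 : (0 <= \big[Rplus/0%R]_(i | P i && ~~ C i) F i)%R.
  by apply: h1 => i /andP[/F0].
have {}h2 : (\big[Rplus/0%R]_(i | P i && C i) c <= \big[Rplus/0%R]_(i | P i && C i) F i)%R.
  by apply: h2 => i /andP[_ /CF[]].
lra.
Qed.

Lemma rejecting_tree (n : nat) (A : Type) (D : seq (R * dtree n A)) (f : 'I_n -> A) :
  valid_dist D -> (0 < prob_reject D f)%R ->
  exists p, [/\ List.In p D, (0 < p.1)%R & decide p.2 f = false].
Proof.
case=> + _; rewrite /prob_reject; elim: D => [|p D IHD] D0.
  by rewrite big_nil; lra.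
have D0' q : List.In q D -> (0 <= q.1)%R by move=> qD; apply: D0; right.
rewrite big_cons; case e: (decide p.2 f).
  rewrite Rplus_0_l => /(IHD D0')[q [qD q0 qf]].
  by exists q; split => //; right.
have [p0|p0] := Rle_lt_or_eq_dec _ _ (D0 p (or_introl erefl)).
  by exists p; split => //; left.
rewrite -p0 Rplus_0_l => /(IHD D0')[q [qD q0 qf]].
by exists q; split => //; right.
Qed.

(** A vanishing sum of nonnegative terms has only zero terms. *)
Lemma accepting_tree (n : nat) (A : Type) (D : seq (R * dtree n A)) (f : 'I_n -> A) p :
  valid_dist D -> prob_reject D f = 0%R -> List.In p D -> (0 < p.1)%R ->
  decide p.2 f.
Proof.
case=> + _; rewrite /prob_reject; elim: D => // q D IHD D0.
have D0' r : List.In r D -> (0 <= r.1)%R by move=> rD; apply: D0; right.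
have q0 := D0 q (or_introl erefl).
have S0 : (0 <= \big[Rplus/0%R]_(r <- D) (if decide r.2 f then 0%R else r.1))%R.
  elim: D D0' {IHD D0} => [|r D IHD] D0; first by rewrite big_nil; lra.
  have r0 := D0 r (or_introl erefl).
  rewrite big_cons; have := IHD (fun s sD => D0 s (or_intror sD)).
  by case: ifP => _; lra.
rewrite big_cons => s0 [<-|pD] p0; last by apply: IHD => //; move: s0; case: ifP => _; lra.
by move: s0; case: (decide q.2 f) => // s0; lra.
Qed.

(** * Weights and distance in the gadget *)

Lemma INR_card_gt0 (T : finType) (x : T) : (0 < INR #|T|)%R.
Proof. by apply: lt_0_INR; apply/ltP/card_gt0P; exists x. Qed.

Lemma gadget_valid (A : finType) (S : relstruct A) m (a : A) :
  (0 < m)%N -> valid_instance (gadget S m).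
Proof.
move=> m0.
have k0 : 'I_m.*2 by apply: (@Ordinal _ 0); rewrite double_gt0.
have p1 := INR_card_gt0 ((k0, (a, a)) : ('I_m.*2 * (A * A))%type).
have p2 := INR_card_gt0 ((true, (a, a)) : (bool * (A * A))%type).
have le1 (T : finType) : (0 < INR #|T|)%R -> (0 <= / (2 * INR #|T|) <= 1)%R.
  move=> T0; have : (1 <= INR #|T|)%R.
    exact: (le_INR 1 _ (INR_lt 0 _ T0)).
  move=> T1; split; first by apply/Rlt_le/Rinv_0_lt_compat; lra.
  by rewrite -Rinv_1; apply: Rinv_le_contravar; lra.
split.
  by move=> x; rewrite /=; case: (enum_val x) => y; apply: le1.
rewrite /total_weight (reindex _ (onW_bij _ (@enum_rank_bij (free_var A m)))) /=.
under eq_bigr => v _ do rewrite enum_rankK.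
rewrite big_sumType /= !Rsum_const.
have half (T : finType) : (0 < INR #|T|)%R -> (INR #|T| * / (2 * INR #|T|) = / 2)%R.
  by move=> T0; field; lra.
transitivity (/ 2 + / 2)%R; last by lra.
by congr (_ + _)%R; apply: half.
Qed.

(** Let K be the number of pairs over A. One entry of c or c' weighs 1/(4K), and so do [m] block
    entries together; the threshold is half of that. *)
Lemma gadget_far (A : finType) (S : relstruct A) m (a : A) :
  (0 < m)%N -> ~~ has_day_chain S ->
  @eps_far A S (gadget S m) (/ (8 * INR #|{: A * A}|))
    (fun x => switched [set: 'I_m.*2] (enum_val x)).
Proof.
move=> m0 noday g /gadget_satisfying[h pol].
set f := fun x => _; set G := fun x => g (enum_rank x) in pol.
have K0 := INR_card_gt0 ((a, a) : (A * A)%type).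
set K := INR _ in K0 *.
have m0R : (0 < INR m)%R by apply/lt_0_INR/ltP.
have [wv _] := gadget_valid S a m0.
apply: Rnot_le_lt => close; move/negP: noday; apply.
pose chg : {set free_var A m} := [set v | switched [set: 'I_m.*2] v != G v].
have distE (C : {set free_var A m}) c : C \subset chg ->
    (forall v, v \in C -> (c <= gadget_weight v)%R) -> (INR #|C| * c <= / (8 * K))%R.
  move=> sC wC; apply: Rle_trans close.
  rewrite -(card_imset _ (@enum_rank_inj _)).
  apply: Rsum_ge_card => [i _|i /imsetP[v vC ->]]; first by case: (wv i).
  split; last by rewrite /= enum_rankK; exact: wC.
  by move/subsetP: sC => /(_ v vC); rewrite inE /f enum_rankK.
have same_c b s t : G (inr (b, (s, t))) = if b then t else s.
  apply/eqP; apply/idPn => neq.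
  have := distE [set inr (b, (s, t))] (/ (4 * K))%R.
  rewrite cards1 sub1set inE /= eq_sym neq => /(_ isT) H.
  suff : (1 * / (4 * K) <= / (8 * K))%R.
    rewrite Rmult_1_l => /(Rinv_le_contravar _ _ _); rewrite !Rinv_inv => h4.
    have : (8 * K <= 4 * K)%R by apply: h4; apply: Rinv_0_lt_compat; lra.
    by lra.
  apply: H => v; rewrite inE => /eqP -> /=.
  rewrite card_prod card_bool mult_INR /= -/K; right; congr (/ _)%R; ring.
pose blk (v : free_var A m) : option 'I_m.*2 :=
  match v with inl (k, _) => Some k | inr _ => None end.
pose C : {set free_var A m} := [set v in chg | blk v != None].
(* Blocks with at least one changed entry; fewer than [m] of the 2m, so the others carry a whole
   chain [phi]. *)
pose bad : {set 'I_m.*2} := [set k | Some k \in blk @: C].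
have badC : (#|bad| <= #|C|)%N.
  apply: leq_trans (leq_imset_card blk C).
  rewrite -(card_imset _ (@Some_inj _)); apply/subset_leq_card/subsetP.
  by move=> _ /imsetP[k kb ->]; rewrite inE in kb.
have bad_lt : (#|bad| < m)%N.
  rewrite ltnNge; apply/negP=> mbad.
  have : (INR #|C| * / (4 * INR m * K) <= / (8 * K))%R.
    apply: distE => [|v]; first by apply/subsetP=> v; rewrite inE => /andP[].
    rewrite inE => /andP[_]; case: v => // v _ /=.
    rewrite card_prod card_ord mult_INR -/K -muln2 mult_INR /=.
    right; congr (/ _)%R; ring.
  have : (INR m <= INR #|C|)%R by apply/le_INR/leP/(leq_trans mbad).
  have : (0 < / (4 * INR m * K))%R.
    by apply: Rinv_0_lt_compat; apply: Rmult_lt_0_compat => //; lra.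
  have e : (INR m * / (4 * INR m * K) = 2 * / (8 * K))%R by field; lra.
  have : (0 < / (8 * K))%R by apply: Rinv_0_lt_compat; lra.
  by nra.
have good : (m <= #|~: bad|)%N.
  by rewrite -(leq_add2l #|bad|) cardsC card_ord -[leqRHS]addnn leq_add2r ltnW.
pose phi : chain_ix m := [ffun k => enum_val (widen_ord good k)].
have inj : injective phi.
  by move=> k l; rewrite !ffunE => /enum_val_inj /(congr1 val) /= /val_inj.
apply: (unchanged_chain_day (f := G) (h := h) (phi := phi) m0).
- by move=> k side; exact: pol.
- move=> k s t; apply/eqP; apply/idPn => neq.
  have : phi k \in ~: bad by rewrite ffunE enum_valP.
  rewrite !inE => /negP; apply; apply/imsetP.
  by exists (inl (phi k, (s, t))) => //; rewrite !inE /= in_setT eq_sym neq.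
- by move=> s t; rewrite same_c.
- by move=> s t; rewrite same_c.
Qed.

(** * The linear lower bound on queries *)

(** With fewer than [m] queries, making all unqueried blocks false satisfies the instance and
    changes no answer seen by the tree. *)
Lemma rejecting_queries (A : finType) (S : relstruct A) m
  (t : dtree (nfree (gadget S m)) A) :
  decide t (fun x => switched [set: 'I_m.*2] (enum_val x)) = false ->
  (forall g, satisfying g -> decide t g) ->
  (m <= nqueries t (fun x => switched [set: 'I_m.*2] (enum_val x)))%N.
Proof.
set f := fun x => _; move=> rej acc; rewrite leqNgt; apply/negP=> few.
pose blk (x : 'I_(nfree (gadget S m))) : option 'I_m.*2 :=
  match enum_val x with inl (k, _) => Some k | inr _ => None end.
pose Q : {set 'I_m.*2} := [set k in pmap blk (queried t f)].
have Qm : (#|Q| < m)%N.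
  rewrite cardsE; apply: leq_ltn_trans (card_size _) _.
  by apply: leq_ltn_trans few; rewrite size_pmap -size_queried count_size.
have := acc _ (@switched_satisfying A S m Q Qm).
rewrite -(@decide_queried _ _ t f) ?rej // => x xq; rewrite /f.
have : blk x \in [seq blk y | y <- queried t f] by exact: map_f.
rewrite /blk; case: (enum_val x) => [[k [s u]]|[]] //= kq.
by rewrite !inE mem_pmap kq.
Qed.

Lemma gadget_nfree (A : finType) (S : relstruct A) m :
  nfree (gadget S m) = (m.+1.*2 * #|{: A * A}|)%N.
Proof. by rewrite /= card_sum !card_prod card_ord card_bool -mulnDl doubleS addn2. Qed.

Theorem mainTheorem17 (A : finType) (S : relstruct A) :
  ~ CM_variety S ->
  exists eps : R, Rlt 0 eps /\
    forall T : tester S, one_sided_tester eps T ->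
      exists c : R, Rlt 0 c /\
        forall N : nat, exists I : instance S,
          valid_instance I /\ (N <= nfree I)%N /\
          makes_queries T I (Rmult c (INR (nfree I))).
Proof.
move=> ncm.
have noday : ~~ has_day_chain S.
  by apply/negP=> day; apply: ncm => B ip; exact: day_chain_modular.
(* Over an empty domain the first and last projections coincide, a trivial Day chain. *)
have [a _] : exists a : A, true.
  case: (pickP (fun _ : A => true)) => [a _|noA]; first by exists a.
  suff e : proj4 A i0 = proj4 A i3 by rewrite /has_day_chain e connect0 in noday.
  by apply/ffunP=> t; have := noA (tnth t i0).
have K0 : (0 < INR #|{: A * A}|)%R by exact: (INR_card_gt0 (a, a)).
exists (/ (8 * INR #|{: A * A}|))%R; split; first by apply: Rinv_0_lt_compat; lra.
(* There are 2(m+1)K free variables, so this constant demands (m+1)/2 queries, at most [m]. *)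
move=> T test; exists (/ (4 * INR #|{: A * A}|))%R.
split; first by apply: Rinv_0_lt_compat; lra.
move=> N; pose m := N.+1; exists (gadget S m).
have val := gadget_valid S a (ltn0Sn N : 0 < m)%N.
have [vT [acc rej]] := test _ val.
have K1 : (0 < #|{: A * A}|)%N by apply/card_gt0P; exists (a, a).
split => //; split.
  rewrite gadget_nfree; apply: leq_trans (leq_pmulr _ K1).
  by rewrite -addnn; apply: leq_trans (leq_addr _ _); rewrite ltnW ?ltnS.
have := rej _ (@gadget_far A S m a (ltn0Sn N) noday).
set f := fun x => _ => pr.
have /(rejecting_tree vT)[p [pT p0 pf]] : (0 < prob_reject (T (gadget S m)) f)%R by lra.
exists p; split => //; split => //; exists f.
have : (m <= nqueries p.2 f)%N.
  apply: rejecting_queries => // g gs.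
  exact: (accepting_tree vT (acc g gs) pT p0).
move/leP/le_INR; apply: Rle_trans.
have -> : INR (nfree (gadget S m)) = (2 * (INR m + 1) * INR #|{: A * A}|)%R.
  rewrite gadget_nfree -muln2 !mult_INR S_INR.
  by rewrite (_ : INR 2 = 2%R) //; ring.
have m1 : (1 <= INR m)%R by apply: (le_INR 1); apply/leP.
have -> : (/ (4 * INR #|{: A * A}|) * (2 * (INR m + 1) * INR #|{: A * A}|) =
           (INR m + 1) / 2)%R by field; lra.
lra.
Qed.
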